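(* Let $B,\bar B$ be real or complex vector spaces and $L(\varepsilon)=\sum_{i=0}^\infty\varepsilon^iL_i$ a formal power series with $L_i\in L(B,\bar B)$, $L(\varepsilon)\not\equiv0$. Run the recursion of the context with some choice of complements. For $i\ge1$ let $B_i:=\bar S_iS_i^{-1}\mathcal P_i\in L(\bar B,\bar B)$, and for $k\ge1$ define $e_{i,k+1}\in L(\bar B,B)$, $i=1,\dots,k$, by $$e_{k,k+1}:=-S_k^{-1}\mathcal P_k,\qquad e_{i,k+1}:=-S_i^{-1}\mathcal P_i(I_{\bar B}-B_{i+1})\cdots(I_{\bar B}-B_k)\quad(1\le i\le k-1).$$ Then for every $k\ge1$ $$(\bar S_1\ \cdots\ \bar S_k)\cdot\begin{pmatrix} e_{1,k+1} \\ \vdots \\ e_{k,k+1} \end{pmatrix}=\sum_{i=1}^k\bar S_ie_{i,k+1}=-(\mathcal P_1+\cdots+\mathcal P_k).$$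
   Context: $L(X,Y)$ denotes the linear maps from $X$ to $Y$; $I_X$ is the identity. Recursion. Put $N_0:=B$, $N_0^c:=\{0\}$, $R_0:=\{0\}$, $R_0^c:=\bar B$, $\bar S_1:=S_1:=L_0$, $E_{1,1}:=M_{1,1}:=I_B$. At each stage $j\ge1$, given $S_j\in L(B,R_{j-1}^c)$, set $N_j:=\{n\in N_{j-1}\mid S_jn=0\}$, $R_j:=S_j(N_{j-1})$ and choose algebraic direct complements $N_{j-1}=N_j^c\oplus N_j$, $R_{j-1}^c=R_j\oplus R_j^c$. Then $B=N_1^c\oplus\cdots\oplus N_j^c\oplus N_j$ and $\bar B=R_1\oplus\cdots\oplus R_j\oplus R_j^c$; $\mathcal P_j$ denotes the projection of $\bar B$ onto $R_j$ defined by the latter decomposition (regarded also as a map into $\bar B$), and $S_j^{-1}:R_j\to N_j^c$ denotes the inverse of the bijection $S_j|_{N_j^c}:N_j^c\to R_j$. At stage $j\ge2$, the operators are defined by $$\bar S_j:=\sum_{i=1}^{j-1}L_iM_{i,j-1},\qquad S_j:=(I_{\bar B}-\mathcal P_1-\cdots-\mathcal P_{j-1})\bar S_j,$$ $$E_{j,j}:=I_B,\qquad E_{i,j}:=-S_i^{-1}\mathcal P_i\sum_{\nu=i+1}^{j}\bar S_\nu E_{\nu,j}\quad (i=j-1,\dots,1),$$ $$M_{1,j}:=E_{1,j},\qquad M_{i,j}:=\sum_{\nu=i}^{j}M_{i-1,\nu-1}E_{\nu,j}\quad(i=2,\dots,j).$$ *)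

(* Defs.v *)
From HB Require Import structures.
From mathcomp Require Import all_boot all_order all_algebra.
From mathcomp Require Import complex.
From mathcomp Require Import boolp classical_sets reals.

Set Implicit Arguments.
Unset Strict Implicit.
Unset Printing Implicit Defensive.

Import GRing.Theory.
Local Open Scope classical_set_scope.
Local Open Scope ring_scope.

Variant scalar_kind := RealScalars | ComplexScalars.

Definition scalar_field (R : realType) (s : scalar_kind) : fieldType :=
  match s with
  | RealScalars => R
  | ComplexScalars => R[i]
  end.

(* [W] is a linear subspace with [U = V (+) W]. *)
Definition direct_complement (K : fieldType) (X : lmodType K)
    (U V W : set X) : Prop :=
  [/\ submod_closed (mem W),
      V `&` W = [set 0]
    & U = [set v + w | v in V & w in W]].

(* Operators are bare functions: that they are linear, and that [S_op j] takes
   its values in [Rcsp j.-1], follows from [recursion_spec] by induction on the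
   stage.
   Only the values of [Sinv_op j] on [Rsp j] and of [E_op i j], [M_op i j] for
   [1 <= i <= j] are meaningful; indices of operators start at 1. *)
Record recursion_data (K : fieldType) (B Bbar : lmodType K) := RecursionData {
  Nsp : nat -> set B;
  Ncsp : nat -> set B;
  Rsp : nat -> set Bbar;
  Rcsp : nat -> set Bbar;
  Sbar_op : nat -> B -> Bbar;
  S_op : nat -> B -> Bbar;
  Sinv_op : nat -> Bbar -> B;
  P_op : nat -> Bbar -> Bbar;
  E_op : nat -> nat -> B -> B;
  M_op : nat -> nat -> B -> B
}.

Record recursion_spec (K : fieldType) (B Bbar : lmodType K)
    (L : nat -> {linear B -> Bbar}) (D : recursion_data B Bbar) : Prop := {
  N_0 : Nsp D 0 = setT;
  Nc_0 : Ncsp D 0 = [set 0];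
  R_0 : Rsp D 0 = [set 0];
  Rc_0 : Rcsp D 0 = setT;
  N_S : forall j, (1 <= j)%N ->
    Nsp D j = [set n | Nsp D j.-1 n /\ S_op D j n = 0];
  R_S : forall j, (1 <= j)%N -> Rsp D j = S_op D j @` Nsp D j.-1;
  Nc_complement : forall j, (1 <= j)%N ->
    direct_complement (Nsp D j.-1) (Nsp D j) (Ncsp D j);
  Rc_complement : forall j, (1 <= j)%N ->
    direct_complement (Rcsp D j.-1) (Rsp D j) (Rcsp D j);
  (* projection onto [Rsp j] along [Bbar = Rsp 1 (+) ... (+) Rsp j (+) Rcsp j] *)
  P_proj : forall j, (1 <= j)%N ->
    forall (r : nat -> Bbar) (c : Bbar),
      (forall i, (1 <= i <= j)%N -> Rsp D i (r i)) -> Rcsp D j c ->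
      P_op D j (\sum_(1 <= i < j.+1) r i + c) = r j;
  Sinv_l : forall j, (1 <= j)%N ->
    forall n, Ncsp D j n -> Sinv_op D j (S_op D j n) = n;
  Sinv_r : forall j, (1 <= j)%N ->
    forall y, Rsp D j y ->
      Ncsp D j (Sinv_op D j y) /\ S_op D j (Sinv_op D j y) = y;
  Sbar_1 : forall x, Sbar_op D 1 x = L 0 x;
  S_1 : forall x, S_op D 1 x = L 0 x;
  Sbar_j : forall j, (2 <= j)%N ->
    forall x, Sbar_op D j x = \sum_(1 <= i < j) L i (M_op D i j.-1 x);
  S_j : forall j, (2 <= j)%N ->
    forall x, S_op D j x =
      Sbar_op D j x - \sum_(1 <= i < j) P_op D i (Sbar_op D j x);
  E_diag : forall j, (1 <= j)%N -> forall x, E_op D j j x = x;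
  E_ij : forall i j, (1 <= i < j)%N ->
    forall x, E_op D i j x =
      - Sinv_op D i (P_op D i
          (\sum_(i.+1 <= nu < j.+1) Sbar_op D nu (E_op D nu j x)));
  M_1j : forall j, (1 <= j)%N -> forall x, M_op D 1 j x = E_op D 1 j x;
  M_ij : forall i j, (2 <= i <= j)%N ->
    forall x, M_op D i j x =
      \sum_(i <= nu < j.+1) M_op D i.-1 nu.-1 (E_op D nu j x)
}.

Definition B_op (K : fieldType) (B Bbar : lmodType K)
    (D : recursion_data B Bbar) (i : nat) (y : Bbar) : Bbar :=
  Sbar_op D i (Sinv_op D i (P_op D i y)).

(* For [j = k.+1], the composite is (I - B_(i+1)) ... (I - B_k), applied from
   right to left; it is the identity when [i = k]. *)
Definition e_op (K : fieldType) (B Bbar : lmodType K)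
    (D : recursion_data B Bbar) (i j : nat) (y : Bbar) : B :=
  - Sinv_op D i (P_op D i
      ((\big[@comp Bbar Bbar Bbar/idfun]_(i.+1 <= nu < j)
          (fun z => z - B_op D nu z)) y)).

(* Main.v *)
(** Telescoping: [B_i (I - B_(i+1)) ... (I - B_k)] is the difference of
    [(I - B_(i+1)) ... (I - B_k)] and [(I - B_i) ... (I - B_k)], so the sum is
    [(I - B_1) ... (I - B_k) - I].  Since
    [(I - P_1 - ... - P_(i-1)) Sbar_i = S_i] and [S_i S_i^-1 P_i = P_i], one has
    [(I - P_1 - ... - P_(i-1)) (I - B_i) = I - P_1 - ... - P_i], whence the
    product is [I - P_1 - ... - P_k].  This uses that the operators are
    additive, which is proved along the recursion by strong induction on the
    stage. *)
Require Import Defs.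
From mathcomp Require Import all_boot all_order all_algebra.
From mathcomp Require Import boolp classical_sets.
From mathcomp Require Import reals.

Set Implicit Arguments.
Unset Strict Implicit.
Unset Printing Implicit Defensive.

Import GRing.Theory.
Local Open Scope ring_scope.

(** The set-level counterpart of [zmod_morphism], which is also phrased with subtraction. *)
Definition sub_stable (V : zmodType) (A : set V) : Prop :=
  forall x y, A x -> A y -> A (x - y).

Lemma zmod_morphism_sum (U V : zmodType) (I : eqType) (r : seq I)
    (F : I -> U -> V) :
  {in r, forall i, zmod_morphism (F i)} ->
  zmod_morphism (fun x => \sum_(i <- r) F i x).
Proof.
move=> FB x y; rewrite -sumrB !big_seq.
by apply: eq_bigr => i ir; rewrite FB.
Qed.

Lemma zmod_morphism_opp (U V : zmodType) (f : U -> V) :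
  zmod_morphism f -> forall x, f (- x) = - f x.
Proof.
move=> fB x; have f0 : f 0 = 0 by rewrite -(subrr 0) fB subrr.
by rewrite -sub0r fB f0 sub0r.
Qed.

Section Recursion.
Context (K : fieldType) (B Bbar : lmodType K) (L : nat -> {linear B -> Bbar}).
Context (D : recursion_data B Bbar) (hD : recursion_spec L D).

Lemma direct_complement_sub_stable (X : lmodType K) (U V W : set X) :
  direct_complement U V W -> sub_stable W.
Proof.
case=> -[_ Wlin] _ _ x y Wx Wy.
rewrite addrC -scaleN1r -in_setE; apply: Wlin; exact/mem_set.
Qed.

Lemma Rcsp_sub_stable j : sub_stable (Rcsp D j).
Proof.
case: j => [|j]; first by rewrite (Rc_0 hD).
exact: direct_complement_sub_stable (Rc_complement hD (ltn0Sn j)).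
Qed.

Lemma Ncsp_sub_stable j : (1 <= j)%N -> sub_stable (Ncsp D j).
Proof.
by move=> j1; apply: direct_complement_sub_stable (Nc_complement hD j1).
Qed.


(** [P_proj] gives the value of [P_op] only on sums in decomposed form; splitting each [Rcsp D j.-1]
    in turn brings every vector into that form. *)
Lemma Rsp_decomposition j y : exists r c,
  [/\ forall i, (1 <= i <= j)%N -> Rsp D i (r i), Rcsp D j c
    & y = \sum_(1 <= i < j.+1) r i + c].
Proof.
elim: j => [|j [r [c [rR cR ->]]]].
  exists (fun=> 0), y; split; last by rewrite big_geq // add0r.
    by move=> [|i].
  by rewrite (Rc_0 hD).
have [_ _ RcE] := Rc_complement hD (ltn0Sn j).
move: cR; rewrite [j.+1.-1]/= in RcE; rewrite RcE => -[v Rv [w Rcw <-]].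
exists (fun i => if i == j.+1 then v else r i), w; split => //.
  move=> i /andP[i1 ij]; have [->//|ne] := eqVneq i j.+1.
  by apply: rR; rewrite i1 -ltnS ltn_neqAle ne.
rewrite [in RHS]big_nat_recr //= eqxx addrA; congr (_ + _ + _).
by apply: eq_big_nat => i /andP[_ ij]; rewrite ltn_eqF.
Qed.

Lemma P_op_Rsp j y : (1 <= j)%N -> Rsp D j (P_op D j y).
Proof.
move=> j1; have [r [c [rR cR ->]]] := Rsp_decomposition j y.
by rewrite (P_proj hD) //; apply: rR; rewrite j1 leqnn.
Qed.

(** Decompositions of [x] and [y] subtract termwise to one of [x - y], from which [P_proj] reads off
    the [j]-th term. *)
Lemma P_op_additive j : (1 <= j)%N ->
  (forall i, (1 <= i <= j)%N -> sub_stable (Rsp D i)) ->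
  zmod_morphism (P_op D j).
Proof.
move=> j1 RB x y.
have [r [c [rR cR ->]]] := Rsp_decomposition j x.
have [r' [c' [rR' cR' ->]]] := Rsp_decomposition j y.
rewrite opprD addrACA -sumrB !(P_proj hD) //.
  by move=> i ij; apply: (RB) => //; [apply: rR | apply: rR'].
exact: Rcsp_sub_stable.
Qed.

(** The difference of the two preimages lies in [Ncsp D j] and is sent by [S_op D j] to [x - y], so
    the left inverse law identifies it. *)
Lemma Sinv_op_sub j : (1 <= j)%N ->
  {morph S_op D j : x y / x - y} ->
  forall x y, Rsp D j x -> Rsp D j y ->
    Sinv_op D j (x - y) = Sinv_op D j x - Sinv_op D j y.
Proof.
move=> j1 SB x y /(Sinv_r hD j1)[Nx Sx] /(Sinv_r hD j1)[Ny Sy].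
rewrite -{1}Sx -{1}Sy -SB (Sinv_l hD) //; exact: Ncsp_sub_stable.
Qed.

(** The induction invariant. [Sinv_op] enters only after [P_op], because its values outside
    [Rsp D j] are arbitrary. *)
Record stage_additive (j : nat) : Prop := StageAdditive {
  Nsp_stable : sub_stable (Nsp D j);
  Rsp_stable : sub_stable (Rsp D j);
  Sbar_additive : zmod_morphism (Sbar_op D j);
  P_additive : zmod_morphism (P_op D j);
  SinvP_additive : zmod_morphism (fun y => Sinv_op D j (P_op D j y))
}.

(** [E_ij] refers to larger first indices only, hence the induction on [j - i]. *)
Lemma E_op_additive i j :
  (forall n, (1 <= n <= j)%N -> stage_additive n) ->
  (1 <= i <= j)%N -> zmod_morphism (E_op D i j).
Proof.
move=> H; have [d] := ubnP (j - i)%N; elim: d i => // d IH i.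
rewrite ltnS leq_subLR => jd /andP[i1].
rewrite leq_eqVlt => /predU1P[Eij|ij] x y.
  by rewrite -Eij !(E_diag hD).
have EB nu : (i < nu < j.+1)%N -> zmod_morphism (E_op D nu j).
  move=> /andP[inu nuj]; apply: IH.
    by rewrite ltn_subLR // (leq_ltn_trans jd) // ltn_add2r.
  by rewrite (leq_trans i1 (ltnW inu)).
rewrite !(E_ij hD) ?i1 //.
have Hi : stage_additive i by apply: H; rewrite i1 ltnW.
rewrite -opprD -(SinvP_additive Hi) -sumrB.
congr (- Sinv_op _ _ (P_op _ _ _)); apply: eq_big_nat => nu /andP[inu nuj].
rewrite EB ?inu // (Sbar_additive (H _ _)) //.
by rewrite (leq_trans i1 (ltnW inu)).
Qed.

Lemma M_op_additive i j :
  (forall n, (1 <= n <= j)%N -> stage_additive n) ->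
  (1 <= i <= j)%N -> zmod_morphism (M_op D i j).
Proof.
elim: i j => // i IH j H /andP[_ ij] x y.
case: i => [|i] in IH ij *.
  by rewrite !(M_1j hD) // E_op_additive.
rewrite !(M_ij hD) // -sumrB; apply: eq_big_nat => -[//|nu] /andP[inu nuj].
rewrite E_op_additive ?nuj //= IH ?andbT //.
by move=> n /andP[n1 nnu]; apply: H; rewrite n1 (leq_trans nnu) // ltnW.
Qed.

(** Only [M_op D i j.-1] enters [Sbar_op D j], so the stages below [j] suffice and there is no
    circularity. *)
Lemma Sbar_op_additive_step j :
  (forall n, (1 <= n < j)%N -> stage_additive n) -> (1 <= j)%N ->
  zmod_morphism (Sbar_op D j).
Proof.
case: j => [//|[|j]] H _ x y; first by rewrite !(Sbar_1 hD) linearB.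
rewrite !(Sbar_j hD) // -sumrB; apply: eq_big_nat => i ij.
by rewrite M_op_additive //= linearB.
Qed.

Lemma S_opE j x : (1 <= j)%N ->
  S_op D j x = Sbar_op D j x - \sum_(1 <= i < j) P_op D i (Sbar_op D j x).
Proof.
case: j => [//|[|j]] _; last by rewrite (S_j hD).
by rewrite (S_1 hD) (Sbar_1 hD) big_geq // subr0.
Qed.

(** Within a stage the properties follow in the order [Sbar_op], [S_op], [Nsp], [Rsp], [P_op],
    [Sinv_op] after [P_op]. *)
Lemma stage_additiveP j : (1 <= j)%N -> stage_additive j.
Proof.
elim/ltn_ind: j => j IH j1.
have H n : (1 <= n < j)%N -> stage_additive n.
  by move=> /andP[n1 nj]; apply: IH.
have SbarB := Sbar_op_additive_step H j1.
have SB : zmod_morphism (S_op D j).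
  move=> x y; rewrite !S_opE // SbarB zmod_morphism_sum; last first.
    by move=> i; rewrite mem_index_iota => /H/P_additive.
  by rewrite opprD addrACA -opprD.
have NB' : sub_stable (Nsp D j.-1).
  case: j j1 H {IH SbarB SB} => [//|[|j]] _ H; first by rewrite (N_0 hD).
  by apply: Nsp_stable; apply: H; rewrite /= ltnS.
have NB : sub_stable (Nsp D j).
  move=> x y; rewrite (N_S hD) //= => -[Nx Sx] [Ny Sy].
  by split; [apply: NB' | rewrite SB Sx Sy subrr].
have RB : sub_stable (Rsp D j).
  move=> x y; rewrite (R_S hD) //= => -[n Nn <-] [m Nm <-].
  by exists (n - m); [apply: NB' | rewrite SB].
have PB : zmod_morphism (P_op D j).
  apply: P_op_additive => // i /andP[i1].
  rewrite leq_eqVlt => /predU1P[->//|ij].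
  by apply: Rsp_stable; apply: H; rewrite i1.
split=> // x y; rewrite PB Sinv_op_sub //; exact: P_op_Rsp.
Qed.

Lemma residual_B_op i z : (1 <= i)%N ->
  z - B_op D i z - \sum_(1 <= n < i) P_op D n (z - B_op D i z)
    = z - \sum_(1 <= n < i.+1) P_op D n z.
Proof.
move=> i1; rewrite zmod_morphism_sum; last first.
  move=> n; rewrite mem_index_iota => /andP[n1 _].
  exact: P_additive (stage_additiveP n1).
have [_ SK] := Sinv_r hD i1 (P_op_Rsp z i1).
(* [SK] now says that subtracting from [B_op D i z] its projections of index below [i] leaves
   [P_op D i z]. *)
rewrite S_opE // -/(B_op D i z) in SK.
by rewrite big_nat_recr //= -[in RHS]SK !opprD !opprK !addrA (addrAC z).
Qed.

(** The tail product starting at factor [i]: [C k i.+1] occurs in [e_op D i k.+1], and [C k k.+1] is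
    the identity. *)
Let C k i := \big[@comp Bbar Bbar Bbar/idfun]_(i <= nu < k.+1)
  (fun z => z - B_op D nu z).

Lemma B_op_product_recl k i y : (i < k.+1)%N ->
  C k i y = C k i.+1 y - B_op D i (C k i.+1 y).
Proof. by move=> ik; rewrite [C k i]/C big_ltn. Qed.

Lemma B_op_product k y : C k 1 y = y - \sum_(1 <= i < k.+1) P_op D i y.
Proof.
(* The [i] leftmost factors are absorbed one at a time into the residual projection; [i = k] leaves
   no factor. *)
have CP i : (i <= k)%N -> C k 1 y =
    C k i.+1 y - \sum_(1 <= n < i.+1) P_op D n (C k i.+1 y).
  elim: i => [|i IH] ik; first by rewrite big_geq // subr0.
  by rewrite IH 1?ltnW // B_op_product_recl // residual_B_op.
by rewrite (CP k) // [C k k.+1]/C big_geq.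
Qed.

Lemma sum_Sbar_e_op k y :
  \sum_(1 <= i < k.+1) Sbar_op D i (e_op D i k.+1 y)
    = - \sum_(1 <= i < k.+1) P_op D i y.
Proof.
(* Each summand is [- B_op D i (C k i.+1 y)], and [B_op_product_recl] writes it as a difference of
   consecutive tails. *)
rewrite (eq_big_nat _ _ (F2 := fun i => - (C k i.+1 y - C k i y))); last first.
  move=> i /andP[i1 ik].
  rewrite /e_op (zmod_morphism_opp (Sbar_additive (stage_additiveP i1))).
  by rewrite (B_op_product_recl y ik) subKr.
rewrite sumrN telescope_sumr // B_op_product [C k k.+1]/C big_geq //=.
by rewrite subKr.
Qed.

End Recursion.

Theorem lemma3 (R : realType) (s : scalar_kind)
    (B Bbar : lmodType (scalar_field R s)) (L : nat -> {linear B -> Bbar})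
    (L_neq0 : ~ (forall i x, L i x = 0))
    (D : recursion_data B Bbar) (hD : recursion_spec L D)
    (k : nat) (hk : (1 <= k)%N) (y : Bbar) :
  \sum_(1 <= i < k.+1) Sbar_op D i (e_op D i k.+1 y)
    = - \sum_(1 <= i < k.+1) P_op D i y.
Proof. exact: sum_Sbar_e_op hD k y. Qed.
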